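(* There is an absolute constant $C>0$ such that the following holds. Let $A\subseteq\mathbb{R}$ be a finite set with $|A|\ge 2$ and suppose that $|AA|=M|A|$ with $M>1$. Then $$\mathsf{E}(A)\le C\,(M\log M)^{\frac{14}{13}}\,|A|^{\frac{32}{13}}\,(\log|A|)^{\frac{71}{65}} .$$
   Context: $AA=\{ab: a,b\in A\}$ is the product set. The additive energy $\mathsf{E}(A)$ is the number of quadruples $(a_1,a_2,a_3,a_4)\in A^4$ with $a_1-a_2=a_3-a_4$. Logarithms are to base $2$. *)

(* Defs.v *)
From HB Require Import structures.
From mathcomp Require Import all_boot all_order all_algebra finmap.
From mathcomp Require Import reals exp.

Set Implicit Arguments.
Unset Strict Implicit.
Unset Printing Implicit Defensive.

Import Order.TTheory GRing.Theory Num.Theory.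

Local Open Scope fset_scope.
Local Open Scope ring_scope.

Definition product_set (R : realType) (A : {fset R}) : {fset R} :=
  [fset a * b | a in A, b in A].

(* A quadruple (a1, a2, a3, a4) is encoded as the nested pair
   ((a1, a2), (a3, a4)). *)
Definition additive_energy (R : realType) (A : {fset R}) : nat :=
  #|` [fset q in (A `*` A) `*` (A `*` A) |
        q.1.1 - q.1.2 == q.2.1 - q.2.2] |.

Definition log2 (R : realType) (x : R) : R := ln x / ln 2.

(* Main.v *)
Require Import Defs.
From HB Require Import structures.
From mathcomp Require Import all_boot all_order all_algebra finmap.
From mathcomp Require Import reals exp.
From mathcomp Require Import ring lra.

Set Implicit Arguments.
Unset Strict Implicit.
Unset Printing Implicit Defensive.

Import Order.TTheory GRing.Theory Num.Theory.

Local Open Scope fset_scope.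
Local Open Scope ring_scope.

(* Write r(c) for the number of representations of c as a difference in A, n = |A|,
   E = sum r^2 and E3 = sum r^3.

   A Szemeredi-Trotter bound applied to the points X * AA and the lines
   w |-> c (w + b), with c in A \ 0 and b in B, shows that a - b = w has at least t
   solutions (a, b) in A * B for at most O(|AA|^2 |B|^2 / (n t^3)) values of w.  Hence
   sum_w r_{A-B}(w)^3 <= K n |B|^2 with K = O(M^2 log n).

   Let m be r truncated at Delta = 2 E3 / E, which keeps half of the energy.  The
   symmetric matrix m(x - y) on A has at least (E/2)^3 / n^2 weighted walks of
   length 3 (Blakley-Roy); since r(x - y) is a Gram matrix dominating it, this forces
   many weighted triangles m(x - y) m(x - u) r(y - u).  Grouping them by differences,
   Cauchy-Schwarz bounds the square of their number by
   E3 * Delta * sum_{a,b} r(a)^2 r(b)^2 r(a - b), and splitting r dyadically and using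
   the third moment bound for the level sets of r yields E^13 = O(log^4 n K E3^6 n^14).
   With E3 <= K n^3 this is E^13 = O(M^14 n^32 log^11 n), and 11/13 <= 71/65.
   Finally M is bounded away from 1, so that M = O(M log M). *)

(** * Finite sums *)

(** Lagrange's identity: the double sum of [(f i * g j - f j * g i) ^+ 2] is twice the difference of
    the two sides. *)
Lemma sum_cauchy_schwarz (R : realFieldType) (I : Type) (s : seq I) (f g : I -> R) :
  (\sum_(i <- s) f i * g i) ^+ 2
    <= (\sum_(i <- s) f i ^+ 2) * (\sum_(i <- s) g i ^+ 2).
Proof.
have : 0 <= \sum_(i <- s) \sum_(j <- s) (f i * g j - f j * g i) ^+ 2.
  by apply: sumr_ge0 => i _; apply: sumr_ge0 => j _; exact: sqr_ge0.
have -> : \sum_(i <- s) \sum_(j <- s) (f i * g j - f j * g i) ^+ 2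
  = 2 * ((\sum_(i <- s) f i ^+ 2) * (\sum_(i <- s) g i ^+ 2)
         - (\sum_(i <- s) f i * g i) ^+ 2).
  transitivity (\sum_(i <- s) (f i ^+ 2 * (\sum_(j <- s) g j ^+ 2)
     + (g i ^+ 2 * (\sum_(j <- s) f j ^+ 2)
     - 2 * (f i * g i) * (\sum_(j <- s) f j * g j)))).
    apply: eq_bigr => i _; rewrite !mulr_sumr -sumrB -big_split /=.
    by apply: eq_bigr => j _; ring.
  by rewrite big_split /= sumrB -!mulr_suml -mulr_sumr; ring.
by move=> h; lra.
Qed.

Lemma sum_one (R : pzRingType) (I : Type) (s : seq I) : \sum_(i <- s) 1 = (size s)%:R :> R.
Proof. by rewrite big_const_seq count_predT iter_addr addr0. Qed.

Lemma sqr_sum_le (R : realFieldType) (I : Type) (s : seq I) (f : I -> R) :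
  (\sum_(i <- s) f i) ^+ 2 <= (size s)%:R * \sum_(i <- s) f i ^+ 2.
Proof.
have := sum_cauchy_schwarz s (fun=> 1) f.
under eq_bigr do rewrite mul1r.
by under [X in _ <= X * _]eq_bigr do rewrite expr1n; rewrite sum_one.
Qed.

Lemma natb_ge0 (R : realFieldType) (b : bool) : 0 <= b%:R :> R.
Proof. exact: ler0n. Qed.

Lemma sum_pred1 (R : pzRingType) (T : choiceType) (A : {fset T}) (a : T) :
  \sum_(x <- A) (x == a)%:R = (a \in A)%:R :> R.
Proof.
case: (boolP (a \in A)) => aA.
  rewrite (big_fsetD1 a) //= eqxx big1_fset ?addr0 // => i.
  by rewrite !inE => /andP[/negPf->].
by rewrite big1_fset // => i iA _; case: eqP => // ia; rewrite -ia iA in aA.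
Qed.

Lemma sum_fset_filter (R : pzRingType) (T : choiceType) (A : {fset T}) (P : pred T) (F : T -> R) :
  \sum_(x <- [fset x in A | P x]) F x = \sum_(x <- A) (P x)%:R * F x.
Proof.
rewrite -big_fset_condE big_mkcond /=; apply: eq_bigr => x _.
by case: (P x); rewrite ?mul1r ?mul0r.
Qed.

Lemma sum_indicator_card (R : pzRingType) (T : choiceType) (A : {fset T}) (P : pred T) :
  \sum_(x <- A) (P x)%:R = #|` [fset x in A | P x]|%:R :> R.
Proof.
rewrite -[#|` [fset x in A | P x]|]/(size _) -sum_one sum_fset_filter.
by apply: eq_bigr => x _; rewrite mulr1.
Qed.

(** * Incidences in a grid *)

(* Along a strictly increasing list, one of two things happens between
   consecutive points: [phi] jumps by more than 1, or they form a close pair. *)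
Lemma size_le_close_pairs (R : realFieldType) (phi : R -> R) (x : R) (s : seq R) :
  path <%R x s ->
  {in x :: s &, forall u v, u < v -> phi u <= phi v} ->
  (size s)%:R <= phi (last x s) - phi x
    + \sum_(u <- x :: s) \sum_(v <- x :: s) ((u < v) && (phi v - phi u <= 1))%:R.
Proof.
elim: s x => [|y s IH] x /=.
  by move=> _ _; rewrite !big_seq1 ltxx /= subrr addr0.
move=> /andP[xy pys] mono.
have {IH} IH := IH y pys (sub_in2 (fun z (zs : z \in y :: s) => mem_behead (s := x :: y :: s) zs) mono).
set S := \sum_(u <- y :: s) _ in IH.
have phixy : phi x <= phi y by apply: mono => //; rewrite !inE eqxx ?orbT.
have : S + ((x < y) && (phi y - phi x <= 1))%:R <=
   \sum_(u <- [:: x, y & s]) \sum_(v <- [:: x, y & s]) ((u < v) && (phi v - phi u <= 1))%:R.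
  rewrite big_cons addrC; apply: lerD.
    rewrite big_cons ltxx /= add0r big_cons lerDl.
    by apply: sumr_ge0 => i _; exact: natb_ge0.
  apply: ler_sum => u _; rewrite [leRHS]big_cons lerDr; exact: natb_ge0.
rewrite -natr1 xy /=.
by case: (leP (phi y - phi x) 1) => h /=; lra.
Qed.

Lemma fset_size_le_close_pairs (R : realFieldType) (phi : R -> R) (H : R) (S : {fset R}) :
  0 <= H ->
  {in S &, forall u v, u < v -> phi u <= phi v} ->
  {in S &, forall u v, phi v - phi u <= H} ->
  #|` S|%:R <= 1 + H + \sum_(u <- S) \sum_(v <- S) ((u < v) && (phi v - phi u <= 1))%:R.
Proof.
move=> H0 mono bnd.
pose s := sort <=%R (enum_fset S).
have ps : perm_eq s (enum_fset S) by rewrite perm_sort.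
have ms z : (z \in s) = (z \in S) by rewrite (perm_mem ps).
have ss : sorted <%R s.
  by rewrite sort_lt_sorted; exact: fset_uniq.
have -> : #|` S| = size s by rewrite (perm_size ps).
rewrite -(perm_big _ ps) /=.
have -> : \sum_(u <- s) \sum_(v <- S) ((u < v) && (phi v - phi u <= 1))%:R
  = \sum_(u <- s) \sum_(v <- s) ((u < v) && (phi v - phi u <= 1))%:R :> R.
  by apply: eq_bigr => u _; rewrite -(perm_big _ ps).
clearbody s; case: s ms ss {ps} => [|x s] ms ss.
  by rewrite !big_nil /= addr0; lra.
have /= h := @size_le_close_pairs R phi x s ss _.
have hl : phi (last x s) - phi x <= H.
  by apply: bnd; rewrite -ms ?mem_last // inE eqxx.
rewrite -natr1; apply: le_trans (_ : phi (last x s) - phi x + _ + 1 <= _).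
  by rewrite lerD2r; apply: h => u v us vs; apply: mono; rewrite -ms.
lra.
Qed.

(** Ranks replace coordinates, so that closeness in a grid does not depend on the spacing of its
    points. *)
Definition rank (R : realFieldType) (X : {fset R}) (w : R) : R :=
  \sum_(x <- X) (x < w)%R%:R.

Section Rank.
Variables (R : realFieldType) (X : {fset R}).

Lemma rank_ge0 w : 0 <= rank X w.
Proof. by apply: sumr_ge0 => i _; exact: natb_ge0. Qed.

Lemma rank_le_card w : rank X w <= #|` X|%:R.
Proof. by rewrite -sum_one; apply: ler_sum => i _; case: (_ < _). Qed.

Lemma rank_mono u v : u <= v -> rank X u <= rank X v.
Proof.
move=> uv; apply: ler_sum => i _; case: (ltP i u) => iu /=; last exact: natb_ge0.
by rewrite (lt_le_trans iu uv).
Qed.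

Lemma card_rank_window u g : 0 <= g -> u \in X ->
  \sum_(v <- X) ((u < v) && (rank X v - rank X u <= g))%:R <= g.
Proof.
move=> g0 uX; rewrite sum_indicator_card.
set V := [fset v in X | _].
have [->|[v0 v0V]] := fset_0Vmem V; first by rewrite cardfs0.
pose s := sort <=%R (enum_fset V).
have ps : perm_eq s (enum_fset V) by rewrite perm_sort.
have ms z : (z \in s) = (z \in V) by rewrite (perm_mem ps).
have ss : sorted <=%R s by apply: sort_sorted; exact: le_total.
have [w wV wmax] : exists2 w, w \in V & {in V, forall v, v <= w}.
  clearbody s; case: (lastP s) ms ss {ps} => [|s' w] ms ss.
    by move: (ms v0); rewrite v0V.
  exists w; first by rewrite -ms mem_rcons inE eqxx.
  move=> v; rewrite -ms mem_rcons inE => /predU1P[->//|vs'].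
  move: ss; rewrite -cats1 (sorted_pairwise le_trans) pairwise_cat => /andP[/allrelP h _].
  by apply: h; rewrite ?inE.
move: (wV); rewrite !inE /= => /andP[wX /andP[uw hw]].
apply: le_trans hw.
(* The elements below [u], the point [u] itself and those of [V] are disjoint families in [X], all
   at most [w]. *)
suff : rank X u + 1 + #|` V|%:R <= rank X w + 1 by lra.
have VX : #|` V|%:R = \sum_(x <- X) (x \in V)%:R :> R.
  rewrite sum_indicator_card; congr (#|` _|%:R).
  by apply/fsetP => z; rewrite !inE /=; case: (z \in X).
suff : rank X u + \sum_(x <- X) (x == u)%:R + \sum_(x <- X) (x \in V)%:R
    <= rank X w + \sum_(x <- X) (x == w)%:R.
  by rewrite VX !sum_pred1 uX wX.
rewrite /rank -!big_split /=; apply: ler_sum => x _.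
have xVw : x \in V -> (x < w) || (x == w).
  by move=> /wmax; rewrite le_eqVlt orbC.
have xVu : x \in V -> u < x by rewrite !inE /= => /andP[_ /andP[]].
have ltw := natb_ge0 R (x < w); have eqw := natb_ge0 R (x == w).
case: (ltgtP x u) => [xu|ux|xu] /=.
- move: ltw eqw; rewrite (lt_trans xu uw) /=.
  case: (boolP (x \in V)) => [/xVu ux|_] /= *; first by rewrite ltNge (ltW xu) in ux.
  lra.
- by case: (boolP (x \in V)) ltw eqw => [/xVw/orP[->|->]|_] /= *; lra.
- subst x; move: ltw eqw; rewrite uw; case: (boolP (u \in V)) => [/xVu uu|_] /= *.
    by rewrite ltxx in uu.
  lra.
Qed.

Lemma close_pairs_le g : 0 <= g ->
  \sum_(u <- X) \sum_(v <- X) ((u < v) && (rank X v - rank X u <= g))%:R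
    <= #|` X|%:R * g.
Proof.
move=> g0; rewrite -sum_one mulr_suml big_seq [leRHS]big_seq.
by apply: ler_sum => u uX; rewrite mul1r; exact: card_rank_window.
Qed.

Lemma close_pairs_sym_le g : 0 <= g ->
  \sum_(u <- X) \sum_(v <- X) ((u != v) && (`|rank X v - rank X u| <= g))%:R
    <= 2 * (#|` X|%:R * g).
Proof.
move=> g0.
apply: (@le_trans _ _ (
  \sum_(u <- X) \sum_(v <- X) ((u < v) && (rank X v - rank X u <= g))%:R +
  \sum_(v <- X) \sum_(u <- X) ((v < u) && (rank X u - rank X v <= g))%:R)).
  rewrite [X in _ + X]exchange_big /= -big_split /=; apply: ler_sum => u _.
  rewrite -big_split /=; apply: ler_sum => v _.
  case: (ltgtP u v) => uv /=; rewrite ?addr0 ?add0r //.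
    by case: (leP `|_| g) => [/ler_normlP[_ ->]|_] //; exact: natb_ge0.
  by rewrite distrC; case: (leP `|_| g) => [/ler_normlP[_ ->]|_] //; exact: natb_ge0.
by rewrite mulr2n mulrDl !mul1r lerD ?close_pairs_le.
Qed.

End Rank.

Lemma sum_pred1_mul (R : pzRingType) (T : choiceType) (A : {fset T}) (a : T) (g : T -> R) :
  \sum_(x <- A) (x == a)%:R * g x = (a \in A)%:R * g a.
Proof.
rewrite -sum_pred1 mulr_suml; apply: eq_bigr => x _.
by case: eqP => [->//|_]; rewrite !mul0r.
Qed.

Section Incidences.
Variable R : realFieldType.

(** Abscissas on a line are taken in increasing order. Ordinates may come in either order, depending
    on the sign of the slope, so [close] is symmetric. *)
Definition close_lt (X : {fset R}) (g u v : R) : bool :=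
  (u < v) && (rank X v - rank X u <= g).

Definition close (Y : {fset R}) (g p q : R) : bool :=
  (p != q) && (`|rank Y q - rank Y p| <= g).

Lemma line_incidences_le (X Y : {fset R}) (b c s : R) :
  c != 0 -> 0 < s -> X != fset0 -> Y != fset0 ->
  \sum_(w <- X) (c * (w + b) \in Y)%:R <= 1 + 2 * s +
    \sum_(u <- X) \sum_(v <- X) (close_lt X (#|` X|%:R / s) u v)%:R *
      ((c * (u + b) \in Y)%:R * ((c * (v + b) \in Y)%:R *
       (close Y (#|` Y|%:R / s) (c * (u + b)) (c * (v + b)))%:R)).
Proof.
move=> c0 s0 X0 Y0.
have cX : 0 < #|` X|%:R :> R by rewrite ltr0n cardfs_gt0.
have cY : 0 < #|` Y|%:R :> R by rewrite ltr0n cardfs_gt0.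
set x := #|` X|%:R in cX *; set y := #|` Y|%:R in cY *.
pose rX w := rank X w * (s / x); pose rY w := rank Y (c * (w + b)) * (s / y).
(* The sign makes [phi] nondecreasing along the line. Both terms range over an interval of length
   [s], so [phi] varies by at most [2 * s], and a step of at most 1 is small in both ranks. *)
pose phi w := if 0 < c then rX w + rY w else rX w - rY w.
have sx : 0 < s / x by rewrite divr_gt0.
have sy : 0 < s / y by rewrite divr_gt0.
have rXb w : 0 <= rX w <= s.
  rewrite /rX mulr_ge0 ?rank_ge0 ?(ltW sx) //= mulrC -mulrA ler_piMr ?(ltW s0) //.
  by rewrite mulrC ler_pdivrMr // mul1r rank_le_card.
have rYb w : 0 <= rY w <= s.
  rewrite /rY mulr_ge0 ?rank_ge0 ?(ltW sy) //= mulrC -mulrA ler_piMr ?(ltW s0) //.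
  by rewrite mulrC ler_pdivrMr // mul1r rank_le_card.
have rXm u v : u < v -> rX u <= rX v.
  by move=> uv; rewrite ler_pM2r // rank_mono // ltW.
have rYm u v : u < v -> if 0 < c then rY u <= rY v else rY v <= rY u.
  move=> uv; case: ltP => hc; rewrite ler_pM2r // rank_mono //.
    by rewrite ler_pM2l // lerD2r ltW.
  by rewrite ler_nM2l ?lerD2r ?(ltW uv) // lt_neqAle c0.
rewrite sum_indicator_card.
apply: le_trans (@fset_size_le_close_pairs R phi (2 * s) _ _ _ _) _.
- by rewrite mulr_ge0 // ltW.
- move=> u v _ _ uv; have := rXm _ _ uv; have := rYm _ _ uv; rewrite /phi.
  by case: ifP => _; lra.
- move=> u v _ _; have := rXb u; have := rXb v; have := rYb u; have := rYb v.
  by rewrite /phi; case: ifP => _; lra.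
rewrite lerD2l !sum_fset_filter; apply: ler_sum => u _.
rewrite sum_fset_filter mulr_sumr; apply: ler_sum => v _.
case: (boolP (c * (u + b) \in Y)) => uY; last by rewrite !(mul0r, mulr0).
case: (boolP (c * (v + b) \in Y)) => vY; last by rewrite !(mul0r, mulr0).
rewrite !mul1r /close_lt /close.
case: (ltP u v) => uv; last by rewrite mul0r.
case: (leP (phi v - phi u) 1) => h /=; last by rewrite mulr_ge0 ?natb_ge0.
have neq : c * (u + b) != c * (v + b).
  by apply/eqP => /(mulfI c0) /addIr uv'; rewrite uv' ltxx in uv.
have inv_s (z t : R) : 0 < t -> (z <= t / s) = (z * (s / t) <= 1).
  move=> t0; rewrite ler_pdivlMr // -[in RHS](divff (lt0r_neq0 t0)) !mulrA.
  by rewrite ler_pM2r // invr_gt0.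
have hX : rank X v - rank X u <= x / s.
  rewrite inv_s // mulrBl -/(rX v) -/(rX u).
  have := rXm _ _ uv; have := rYm _ _ uv; move: h; rewrite /phi.
  by case: ifP => _; lra.
have hY : `|rank Y (c * (v + b)) - rank Y (c * (u + b))| <= y / s.
  rewrite inv_s // -[s / y]gtr0_norm // -normrM mulrBl -/(rY v) -/(rY u).
  have := rXm _ _ uv; have := rYm _ _ uv; move: h; rewrite /phi ler_norml.
  by case: ifP => _ *; apply/andP; split; lra.
by rewrite hX hY neq mulr1.
Qed.

(* Two distinct points lie on at most one of the lines [w |-> c * (w + b)]. *)
Lemma lines_through_two_points_le (B C : {fset R}) (u v p q : R) :
  0 \notin C -> u != v ->
  \sum_(c <- C) \sum_(b <- B) (p == c * (u + b))%:R * (q == c * (v + b))%:R <= 1 :> R.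
Proof.
move=> C0 uv; have vu : v - u != 0 by rewrite subr_eq0 eq_sym.
pose c0 := (q - p) / (v - u); pose b0 := p / c0 - u.
apply: (@le_trans _ _ (\sum_(c <- C) \sum_(b <- B) (c == c0)%:R * (b == b0)%:R)).
  rewrite big_seq [leRHS]big_seq; apply: ler_sum => c cC; apply: ler_sum => b _.
  have cn0 : c != 0 by apply: contraNneq C0 => <-.
  case: eqP => [pE|_]; last by rewrite mul0r mulr_ge0 ?natb_ge0.
  case: eqP => [qE|_]; last by rewrite mulr0 mulr_ge0 ?natb_ge0.
  have cE : c = c0 by rewrite /c0 qE pE; field.
  have bE : b = b0 by rewrite /b0 -cE pE; field.
  by rewrite -cE -bE !eqxx.
under eq_bigr do rewrite -mulr_sumr.
rewrite -mulr_suml !sum_pred1.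
by case: (_ \in _); case: (_ \in _); rewrite ?mulr0 ?mul0r ?mulr1 ?ler01.
Qed.

(* The Szemeredi-Trotter bound for the grid [X * Y], by counting pairs of
   consecutive incidences on a line that are close in both ranks. *)
Lemma grid_incidences_le (X Y B C : {fset R}) (s : R) :
  0 \notin C -> 0 < s ->
  \sum_(c <- C) \sum_(b <- B) \sum_(w <- X) (c * (w + b) \in Y)%:R
    <= #|` C|%:R * #|` B|%:R * (1 + 2 * s)
       + 2 * (#|` X|%:R * #|` Y|%:R / s) ^+ 2.
Proof.
move=> C0 s0; set x := #|` X|%:R; set y := #|` Y|%:R.
have rhs0 : 0 <= #|` C|%:R * #|` B|%:R * (1 + 2 * s) + 2 * (x * y / s) ^+ 2.
  have s20 : 0 <= 1 + 2 * s by lra.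
  by apply: addr_ge0; apply: mulr_ge0 => //; [apply: mulr_ge0 | exact: sqr_ge0].
have [X0|X0] := eqVneq X fset0.
  rewrite big1 // => c _; rewrite big1 // => b _.
  by rewrite X0 big_seq_fset0.
have [Y0|Y0] := eqVneq Y fset0.
  rewrite big1 // => c _; rewrite big1 // => b _.
  by rewrite big1 // => w _; rewrite Y0 inE.
pose K u v p q := (close_lt X (x / s) u v)%:R * (close Y (y / s) p q)%:R : R.
(* The ordinates become summation variables [p], [q], so that the sum over lines can be moved inside
   and counts the lines through two given points. *)
apply: (@le_trans _ _ (\sum_(c <- C) \sum_(b <- B) (1 + 2 * s +
   \sum_(u <- X) \sum_(v <- X) \sum_(p <- Y) \sum_(q <- Y)
     K u v p q * ((p == c * (u + b))%:R * (q == c * (v + b))%:R)))).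
  rewrite big_seq [leRHS]big_seq; apply: ler_sum => c cC; apply: ler_sum => b _.
  have cn0 : c != 0 by apply: contraNneq C0 => <-.
  apply: le_trans (line_incidences_le b cn0 s0 X0 Y0) _.
  rewrite lerD2l; apply: ler_sum => u _; apply: ler_sum => v _.
  rewrite -/x -/y le_eqVlt; apply/orP; left; apply/eqP.
  rewrite -(sum_pred1_mul Y (c * (u + b)) (fun p => (c * (v + b) \in Y)%:R *
    (close Y (y / s) p (c * (v + b)))%:R)) mulr_sumr; apply: eq_bigr => p _.
  rewrite -(sum_pred1_mul Y (c * (v + b)) (fun q => (close Y (y / s) p q)%:R)).
  rewrite !mulr_sumr; apply: eq_bigr => q _.
  by rewrite /K; ring.
have -> : \sum_(c <- C) \sum_(b <- B) (1 + 2 * s +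
   \sum_(u <- X) \sum_(v <- X) \sum_(p <- Y) \sum_(q <- Y)
     K u v p q * ((p == c * (u + b))%:R * (q == c * (v + b))%:R)) =
   #|` C|%:R * #|` B|%:R * (1 + 2 * s) +
   \sum_(u <- X) \sum_(v <- X) \sum_(p <- Y) \sum_(q <- Y) K u v p q *
     \sum_(c <- C) \sum_(b <- B) (p == c * (u + b))%:R * (q == c * (v + b))%:R.
  under eq_bigr do rewrite big_split /=.
  rewrite big_split /=; congr (_ + _).
    by rewrite -[#|` C|%:R]sum_one -[#|` B|%:R]sum_one !mulr_suml; apply: eq_bigr => c _;
      rewrite mul1r !mulr_suml; apply: eq_bigr => b _; rewrite mul1r.
  under eq_bigr do rewrite exchange_big /=.
  rewrite exchange_big /=; apply: eq_bigr => u _.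
  under eq_bigr do rewrite exchange_big /=.
  rewrite exchange_big /=; apply: eq_bigr => v _.
  under eq_bigr do rewrite exchange_big /=.
  rewrite exchange_big /=; apply: eq_bigr => p _.
  under eq_bigr do rewrite exchange_big /=.
  rewrite exchange_big /=; apply: eq_bigr => q _.
  by rewrite mulr_sumr; apply: eq_bigr => c _; rewrite mulr_sumr.
rewrite lerD2l.
apply: (@le_trans _ _ (\sum_(u <- X) \sum_(v <- X) \sum_(p <- Y) \sum_(q <- Y) K u v p q)).
  do 4 (apply: ler_sum => ? _); rewrite /K /close_lt.
  case: ltP => uv /=; last by rewrite !mul0r.
  rewrite ler_piMr ?mulr_ge0 ?natb_ge0 // lines_through_two_points_le //.
  by rewrite (lt_eqF uv).
have -> : \sum_(u <- X) \sum_(v <- X) \sum_(p <- Y) \sum_(q <- Y) K u v p q =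
  (\sum_(u <- X) \sum_(v <- X) (close_lt X (x / s) u v)%:R) *
  (\sum_(p <- Y) \sum_(q <- Y) (close Y (y / s) p q)%:R).
  rewrite mulr_suml; apply: eq_bigr => u _; rewrite mulr_suml; apply: eq_bigr => v _.
  by rewrite mulr_sumr; apply: eq_bigr => p _; rewrite mulr_sumr.
apply: (@le_trans _ _ ((x * (x / s)) * (2 * (y * (y / s))))); last first.
  by rewrite le_eqVlt; apply/orP; left; apply/eqP; field; rewrite lt0r_neq0.
apply: ler_pM.
- by apply: sumr_ge0 => u _; apply: sumr_ge0 => v _; exact: natb_ge0.
- by apply: sumr_ge0 => u _; apply: sumr_ge0 => v _; exact: natb_ge0.
- by apply: close_pairs_le; rewrite divr_ge0 ?ler0n ?(ltW s0).
- by apply: close_pairs_sym_le; rewrite divr_ge0 ?ler0n ?(ltW s0).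
Qed.

End Incidences.

(** * Third moment of the representation function *)

(** For [x >= 1], the term with [2 ^+ j <= x < 2 ^+ j.+1] alone dominates [x ^+ k]. *)
Lemma dyadic_expr_le (R : realFieldType) (x : R) (k J : nat) :
  (0 < k)%N -> (x == 0) || (1 <= x) -> x < 2 ^+ J ->
  x ^+ k <= \sum_(j < J) (2 ^+ j.+1) ^+ k * (2 ^+ j <= x)%R%:R.
Proof.
move=> k0 /predU1P[->|x1].
  move=> _; rewrite expr0n eqn0Ngt k0 /=; apply: sumr_ge0 => j _.
  by rewrite mulr_ge0 ?ler0n // !exprn_ge0.
elim: J => [|J IH] xJ; first by rewrite expr0 ltNge x1 in xJ.
rewrite big_ord_recr /=; case: (leP (2 ^+ J) x) => h.
  rewrite mulr1; apply: (@le_trans _ _ ((2 ^+ J.+1) ^+ k)).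
    by rewrite lerXn2r ?nnegrE ?exprn_ge0 ?(le_trans ler01 x1) // ltW.
  rewrite lerDr; apply: sumr_ge0 => j _.
  by rewrite mulr_ge0 ?ler0n // !exprn_ge0.
by rewrite mulr0 addr0 IH.
Qed.

Definition rep (R : realFieldType) (A B : {fset R}) (w : R) : R :=
  \sum_(b <- B) (w + b \in A)%:R.

(** * Representation functions of differences *)

Section Representations.
Variable R : realFieldType.
Implicit Types A B D X : {fset R}.

Lemma rep_ge0 A B w : 0 <= rep A B w.
Proof. by apply: sumr_ge0 => b _; exact: natb_ge0. Qed.

Lemma rep_le_cardr A B w : rep A B w <= #|` B|%:R.
Proof. by rewrite -sum_one; apply: ler_sum => b _; case: (_ \in _). Qed.

Lemma rep_le_cardl A B w : rep A B w <= #|` A|%:R.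
Proof.
rewrite /rep; under eq_bigr do rewrite -sum_pred1.
rewrite exchange_big /= -sum_one; apply: ler_sum => a _.
rewrite (eq_bigr (fun b => (b == a - w)%:R)) => [|b _].
  by rewrite sum_pred1; case: (_ \in _).
by rewrite [in RHS]eq_sym subr_eq [b + w]addrC.
Qed.

Lemma rep_eq0_or_ge1 A B w : (rep A B w == 0) || (1 <= rep A B w).
Proof.
rewrite /rep (sum_indicator_card R B (fun b => w + b \in A)).
by case: #|` _| => [|n]; rewrite ?eqxx // ler1n orbT.
Qed.

Lemma sum_shift A D b (G : R -> R) : {in A, forall a, a - b \in D} ->
  \sum_(a <- A) G a = \sum_(c <- D) (c + b \in A)%:R * G (c + b).
Proof.
move=> AD; rewrite -(sum_fset_filter D (fun c => c + b \in A) (fun c => G (c + b))).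
have AE : A = [fset c + b | c in [fset c in D | c + b \in A]].
  apply/fsetP => a; apply/idP/imfsetP => [aA|[c]].
    by exists (a - b); rewrite ?subrK // !inE /= AD //= subrK.
  by rewrite !inE /= => /andP[_ ?] ->.
by rewrite {1}AE big_imfset //= => ? ? _ _ /addIr.
Qed.

(** Substituting [b = z + v] exhibits [rep A A (u - v)] as the inner product of the indicators of
    the translates [A - u] and [A - v]: a Gram matrix. *)
Lemma rep_sub A D u v : {in A, forall x, x - v \in D} ->
  rep A A (u - v) = \sum_(z <- D) (z + u \in A)%:R * (z + v \in A)%:R.
Proof.
move=> AD; rewrite /rep (sum_shift _ AD); apply: eq_bigr => z _.
by rewrite mulrC; congr ((_ \in A)%:R * _); ring.
Qed.

Lemma rep_opp A w : rep A A (- w) = rep A A w.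
Proof.
pose D := [fset a - w | a in A] `|` A.
have hD (a : R) : a \in A -> (a - w \in D) /\ (a - 0 \in D).
  move=> aA; rewrite subr0 !in_fsetU aA orbT; split=> //.
  by apply/orP; left; apply/imfsetP; exists a.
rewrite -[- w]add0r -[in RHS](subr0 w) (@rep_sub A D); last by move=> a /hD[].
rewrite (@rep_sub A D); last by move=> a /hD[].
by apply: eq_bigr => z _; rewrite mulrC.
Qed.

Lemma sum_rep_le A B X : \sum_(w <- X) rep A B w <= #|` A|%:R * #|` B|%:R.
Proof.
rewrite /rep exchange_big /= mulrC -[#|` B|%:R]sum_one mulr_suml.
apply: ler_sum => b _; rewrite mul1r.
apply: le_trans (rep_le_cardl A X b).
by rewrite /rep; apply: ler_sum => w _; rewrite addrC.
Qed.

End Representations.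

Section ThirdMoment.
Variable R : realType.
Implicit Types A B X : {fset R}.

Lemma card_le_product_set A : A `\ 0%R != fset0 -> (#|` A| <= #|` product_set A|)%N.
Proof.
move=> /fset0Pn[c]; rewrite !inE => /andP[c0 cA].
have <- : #|` [fset c * a | a in A]| = #|` A|.
  by rewrite card_imfset //= => x y /(mulfI c0).
apply: fsubset_leq_card; apply/fsubsetP => x /imfsetP[a /= aA ->].
by apply/imfset2P; exists c => //; exists a.
Qed.

(** If [w + b] lies in [A], then every nonzero [c] in [A] gives an incidence [c * (w + b)] in the
    product set. The resulting lower bound for incidences is played against [grid_incidences_le]. *)
Lemma level_set_card_le A B X (t : R) :
  0 < t -> {in X, forall w, t <= rep A B w} ->
  #|` X|%:R * t ^+ 3 * #|` A `\ 0%R|%:R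
    <= 128 * #|` product_set A|%:R ^+ 2 * #|` B|%:R ^+ 2.
Proof.
move=> t0 tX.
have [X0|/fset0Pn[w0 w0X]] := eqVneq X fset0.
  by rewrite X0 cardfs0 !mul0r !mulr_ge0 ?exprn_ge0 ?ler0n.
have [C0|C0] := eqVneq (A `\ 0%R) fset0.
  by rewrite C0 cardfs0 !mulr0 !mulr_ge0 ?exprn_ge0 ?ler0n.
have AY := card_le_product_set C0.
have CA : (#|` A `\ 0%R| <= #|` A|)%N by rewrite fsubset_leq_card // fsubD1set.
have tB : t <= #|` B|%:R := le_trans (tX _ w0X) (rep_le_cardr _ _ _).
have tA : t <= #|` A|%:R := le_trans (tX _ w0X) (rep_le_cardl _ _ _).
have x1 : 1 <= #|` X|%:R :> R.
  by rewrite ler1n cardfs_gt0; apply/fset0Pn; exists w0.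
have inc : #|` X|%:R * #|` A `\ 0%R|%:R * t <=
    \sum_(c <- A `\ 0) \sum_(b <- B) \sum_(w <- X) (c * (w + b) \in product_set A)%:R.
  rewrite mulrAC mulrC -[#|` A `\ 0%R|%:R]sum_one mulr_suml.
  rewrite big_seq [leRHS]big_seq; apply: ler_sum => c.
  rewrite !inE => /andP[c0 cA]; rewrite mul1r -[#|` X|%:R]sum_one mulr_suml exchange_big /=.
  rewrite big_seq [leRHS]big_seq; apply: ler_sum => w wX; rewrite mul1r.
  apply: le_trans (tX _ wX) _; apply: ler_sum => b _.
  case: (boolP (w + b \in A)) => wbA; last exact: natb_ge0.
  rewrite (_ : c * (w + b) \in product_set A) //.
  by apply/imfset2P; exists c => //; exists (w + b).
move: AY CA; rewrite -!(ler_nat R); move: tB tA x1 inc.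
set x := #|` X|%:R; set n := #|` A|%:R; set m := #|` A `\ 0%R|%:R.
set y := #|` product_set A|%:R; set k := #|` B|%:R => tB tA x1 inc ny mn.
have k0 : 0 < k := lt_le_trans t0 tB.
have m0 : 0 <= m by exact: ler0n.
(* This value of [s] makes the term [m * k * (2 * s)] equal to half of the incidences guaranteed. *)
have s0 : 0 < t * x / (4 * k) by rewrite divr_gt0 ?mulr_gt0 // (lt_le_trans ltr01 x1).
have {inc} := le_trans inc (grid_incidences_le X (product_set A) B _ s0).
rewrite !inE eqxx /= -/x -/y -/m -/k => /(_ isT) inc.
(* Here [m * k] is at most a quarter of the incidences and is absorbed. In the opposite case
   [t * x < 4 * k] and the trivial bounds [t <= k], [t <= n <= y], [m <= y] suffice. *)
case: (leP (4 * k) (t * x)) => kx.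
  have : m * k * 4 <= m * (t * x) by rewrite -mulrA ler_wpM2l // mulrC.
  have E1 : m * k * (1 + 2 * (t * x / (4 * k))) = m * k + m * (t * x) / 2.
    by field; rewrite lt0r_neq0.
  have E2 : 2 * (x * y / (t * x / (4 * k))) ^+ 2 = 32 * y ^+ 2 * k ^+ 2 / t ^+ 2.
    by field; rewrite !lt0r_neq0 // (lt_le_trans ltr01 x1).
  rewrite E1 E2 in inc; move=> h.
  have {}h : x * m * t / 4 <= 32 * y ^+ 2 * k ^+ 2 / t ^+ 2 by lra.
  move: h; rewrite ler_pdivlMr ?exprn_gt0 // => h.
  have -> : x * t ^+ 3 * m = 4 * (x * m * t / 4 * t ^+ 2) by field.
  lra.
have h1 : x * t ^+ 3 * m <= 4 * k * t ^+ 2 * m.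
  have -> : x * t ^+ 3 * m = t * x * t ^+ 2 * m by ring.
  by rewrite ler_wpM2r // ler_wpM2r ?sqr_ge0 // ltW.
have h2 : t ^+ 2 <= k * y.
  by rewrite expr2 ler_pM // ?(ltW t0) // (le_trans tA).
apply: (le_trans h1); apply: (@le_trans _ _ (4 * k * (k * y) * y)).
  apply: ler_pM => //; last exact: le_trans mn ny.
    by rewrite mulr_ge0 ?sqr_ge0 // mulr_ge0 // ltW.
  by rewrite ler_wpM2l // mulr_ge0 // ltW.
have : 0 <= y ^+ 2 * k ^+ 2 by rewrite mulr_ge0 ?sqr_ge0.
have -> : 4 * k * (k * y) * y = 4 * (y ^+ 2 * k ^+ 2) by ring.
lra.
Qed.

Lemma third_moment_le A B X (J : nat) :
  (2 <= #|` A|)%N -> (#|` A| < 2 ^ J)%N ->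
  #|` A|%:R * \sum_(w <- X) rep A B w ^+ 3
    <= 2048 * J%:R * #|` product_set A|%:R ^+ 2 * #|` B|%:R ^+ 2.
Proof.
move=> A2 AJ.
pose K : R := #|` product_set A|%:R ^+ 2 * #|` B|%:R ^+ 2.
have K0 : 0 <= K by rewrite mulr_ge0 ?sqr_ge0.
(* Since [A] has at least two elements, removing 0 keeps at least half of them. *)
have nm : #|` A|%:R <= 2 * #|` A `\ 0%R|%:R :> R.
  rewrite -natrM ler_nat mul2n -addnn; move: A2; rewrite (cardfsD1 0%R A).
  by case: (0%R \in A) => /= A2; [rewrite leq_add2r | rewrite leq_addr].
have -> : 2048 * J%:R * #|` product_set A|%:R ^+ 2 * #|` B|%:R ^+ 2 = 2 * (J%:R * (1024 * K)).
  by rewrite /K; ring.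
apply: (@le_trans _ _ (2 * #|` A `\ 0%R|%:R * \sum_(w <- X) rep A B w ^+ 3)).
  by apply: ler_wpM2r => //; apply: sumr_ge0 => w _; rewrite exprn_ge0 // rep_ge0.
rewrite -mulrA ler_pM2l //.
apply: (@le_trans _ _ (#|` A `\ 0%R|%:R * \sum_(w <- X) \sum_(j < J) (2 ^+ j.+1) ^+ 3 * (2 ^+ j <= rep A B w)%R%:R)).
  apply: ler_wpM2l => //; apply: ler_sum => w _; apply: dyadic_expr_le => //.
    exact: rep_eq0_or_ge1.
  by apply: le_lt_trans (rep_le_cardl _ _ _) _; rewrite -natrX ltr_nat.
rewrite exchange_big /= mulr_sumr.
have -> : J%:R * (1024 * K) = \sum_(j < J) 1024 * K.
  by rewrite sumr_const card_ord mulr_natl.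
apply: ler_sum => j _; rewrite -mulr_sumr.
rewrite (sum_indicator_card R X (fun w => 2 ^+ j <= rep A B w)).
set Xj := [fset w in X | _].
have j0 : 0 < 2 ^+ j :> R by rewrite exprn_gt0.
have := @level_set_card_le A B Xj _ j0 _.
rewrite -[_ * _ * #|` B|%:R ^+ 2]mulrA -/K => h.
have {}h : #|` Xj|%:R * (2 ^+ j) ^+ 3 * #|` A `\ 0%R|%:R <= 128 * K.
  by apply: h => w; rewrite !inE => /andP[].
have -> : #|` A `\ 0%R|%:R * ((2 ^+ j.+1) ^+ 3 * #|` Xj|%:R)
  = 8 * (#|` Xj|%:R * (2 ^+ j) ^+ 3 * #|` A `\ 0%R|%:R) :> R.
  by rewrite (exprS 2 j); ring.
lra.
Qed.

End ThirdMoment.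

(** * Inequalities for moments and walks *)

Lemma sum2_cauchy_schwarz (R : realFieldType) (I J : Type) (s : seq I) (t : seq J)
    (f g : I -> J -> R) :
  (\sum_(i <- s) \sum_(j <- t) f i j * g i j) ^+ 2
    <= (\sum_(i <- s) \sum_(j <- t) f i j ^+ 2)
       * (\sum_(i <- s) \sum_(j <- t) g i j ^+ 2).
Proof.
have := sum_cauchy_schwarz [seq (i, j) | i <- s, j <- t]
  (fun p => f p.1 p.2) (fun p => g p.1 p.2).
by rewrite !big_allpairs.
Qed.

(** Cauchy-Schwarz applied to the powers 1/2 and 3/2 of [f]. *)
Lemma sum_sqr_logconvex (R : rcfType) (I : Type) (s : seq I) (f : I -> R) :
  (forall i, 0 <= f i) ->
  (\sum_(i <- s) f i ^+ 2) ^+ 2 <= (\sum_(i <- s) f i) * (\sum_(i <- s) f i ^+ 3).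
Proof.
move=> f0; have := sum_cauchy_schwarz s (fun i => Num.sqrt (f i))
  (fun i => f i * Num.sqrt (f i)).
have sqE i : Num.sqrt (f i) ^+ 2 = f i by rewrite sqr_sqrtr.
have e2 i : Num.sqrt (f i) * (f i * Num.sqrt (f i)) = f i ^+ 2.
  by rewrite mulrCA -expr2 sqE expr2.
have e3 i : (f i * Num.sqrt (f i)) ^+ 2 = f i ^+ 3 by rewrite exprMn sqE -exprSr.
by under eq_bigr do rewrite e2; under [X in _ <= X * _]eq_bigr do rewrite sqE;
  under [X in _ <= _ * X]eq_bigr do rewrite e3.
Qed.

(** AM-GM for three numbers of product 1. With [t] the square root of [p * q] and [p + q >= 2 * t],
    it reduces to [t * ((t - 1) ^+ 2 * (t + 2)) >= 0]. *)
Lemma amgm3 (R : rcfType) (p q : R) : 0 < p -> 0 < q -> 3 <= p * q + p^-1 + q^-1.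
Proof.
move=> p0 q0; have pq0 : 0 < p * q by rewrite mulr_gt0.
rewrite -(ler_pM2r pq0).
have -> : (p * q + p^-1 + q^-1) * (p * q) = (p * q) ^+ 2 + (p + q).
  by field; rewrite !lt0r_neq0.
have t0 := sqrtr_ge0 (p * q); have := sqr_sqrtr (ltW pq0).
move: t0; set t := Num.sqrt _ => t0 tE.
have pq2t : 2 * t <= p + q.
  rewrite -(@ler_pXn2r _ 2) ?nnegrE ?mulr_ge0 ?addr_ge0 ?(ltW p0) ?(ltW q0) //.
  rewrite exprMn tE; have := sqr_ge0 (p - q); lra.
rewrite -tE; apply: (@le_trans _ _ ((t ^+ 2) ^+ 2 + 2 * t)); last by rewrite lerD2l.
have : 0 <= t * ((t - 1) ^+ 2 * (t + 2)).
  by rewrite mulr_ge0 // mulr_ge0 ?sqr_ge0 // addr_ge0.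
have -> : t * ((t - 1) ^+ 2 * (t + 2)) = (t ^+ 2) ^+ 2 + 2 * t - 3 * t ^+ 2 by ring.
lra.
Qed.

(* The Blakley-Roy inequality for walks of length 3: with [d] the degrees and [e]
   their average, sum [3 <= d y * d u / e ^ 2 + e / d y + e / d u] with weights [m y u]. *)
Lemma walks3_ge (R : rcfType) (I : eqType) (s : seq I) (m : I -> I -> R) :
  (forall x y, 0 <= m x y) -> (forall x y, m x y = m y x) ->
  (\sum_(x <- s) \sum_(y <- s) m x y) ^+ 3 <= (size s)%:R ^+ 2 *
    \sum_(y <- s) \sum_(u <- s) (\sum_(x <- s) m x y) * (\sum_(x <- s) m x u) * m y u.
Proof.
move=> m0 msym; rewrite exchange_big /=.
pose d y := \sum_(x <- s) m x y; pose W1 := \sum_(y <- s) d y.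
pose W3 := \sum_(y <- s) \sum_(u <- s) d y * d u * m y u.
have d0 y : 0 <= d y by apply: sumr_ge0.
have W30 : 0 <= W3.
  by apply: sumr_ge0 => y _; apply: sumr_ge0 => u _; rewrite !mulr_ge0.
rewrite -/W3 -/W1; set n := (size s)%:R.
have [W10|W1n0] := eqVneq W1 0; first by rewrite W10 expr0n /= mulr_ge0 // sqr_ge0.
have W1gt0 : 0 < W1 by rewrite lt_neqAle eq_sym W1n0 sumr_ge0.
have n0 : 0 < n.
  rewrite ltr0n lt0n; apply: contraNneq W1n0 => /size0nil s0.
  by rewrite /W1 s0 big_nil.
pose e := W1 / n; have e0 : 0 < e by rewrite divr_gt0.
have md y u : u \in s -> y \in s -> m y u != 0 -> (0 < d y) && (0 < d u).
  move=> us ys muy; have gt_d a b : b \in s -> m b a != 0 -> 0 < d a.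
    move=> bs mab; rewrite lt_neqAle d0 andbT eq_sym.
    apply: contraNneq mab => /eqP; rewrite psumr_eq0 // => /allP /(_ _ bs) /=.
    by [].
  by rewrite (gt_d y u) ?(gt_d u y) // msym.
have pointwise y u : y \in s -> u \in s ->
    3 * m y u <= d y * d u * m y u / e ^+ 2 + e * (m y u / d y) + e * (m y u / d u).
  move=> ys us; have [->|muy] := eqVneq (m y u) 0; first by rewrite !(mulr0, mul0r, addr0).
  have /andP[dy du] := md _ _ us ys muy.
  have := @amgm3 R (d y / e) (d u / e); rewrite !divr_gt0 // => /(_ isT isT).
  rewrite -(@ler_pM2r _ (m y u)) ?lt_neqAle ?m0 1?eq_sym ?muy //.
  set L := (X in _ <= X -> _); set Q := (X in _ -> _ <= X).
  rewrite (_ : L = Q) // /L /Q; field; by rewrite !lt0r_neq0.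
(* The sum is 1 unless [d y = 0], when division by zero makes it 0. *)
have sum_div y : \sum_(u <- s) m y u / d y <= 1.
  rewrite -mulr_suml (eq_bigr (fun u => m u y)) => [|u _]; last exact: msym.
  by rewrite -/(d y); have [->|dn] := eqVneq (d y) 0; rewrite ?mul0r ?ler01 // divff.
have key : 3 * W1 <= W3 / e ^+ 2 + e * n + e * n.
  have -> : 3 * W1 = \sum_(y <- s) \sum_(u <- s) 3 * m y u.
    rewrite /W1 mulr_sumr; apply: eq_bigr => y _; rewrite -mulr_sumr; congr (_ * _).
    by apply: eq_bigr => x _.
  apply: (@le_trans _ _ (\sum_(y <- s) \sum_(u <- s)
     (d y * d u * m y u / e ^+ 2 + e * (m y u / d y) + e * (m y u / d u)))).
    rewrite big_seq [leRHS]big_seq; apply: ler_sum => y ys.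
    by rewrite big_seq [leRHS]big_seq; apply: ler_sum => u us; exact: pointwise.
  under eq_bigr do rewrite !big_split /=.
  rewrite !big_split /=; apply: lerD; first apply: lerD.
  - by rewrite /W3 mulr_suml; apply: ler_sum => y _; rewrite mulr_suml.
  - under eq_bigr do rewrite -mulr_sumr.
    rewrite -mulr_sumr ler_pM2l // /n -sum_one; apply: ler_sum => y _; exact: sum_div.
  - rewrite exchange_big /=; under eq_bigr do rewrite -mulr_sumr.
    rewrite -mulr_sumr ler_pM2l // /n -sum_one; apply: ler_sum => y _.
    by rewrite (eq_bigr (fun u => m y u / d y)) // => u _; rewrite msym.
have en : e * n = W1 by rewrite /e divfK // lt0r_neq0.
rewrite en in key.
have {key} : W1 <= W3 / e ^+ 2 by lra.
rewrite ler_pdivlMr ?exprn_gt0 // /e => h.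
have -> : W1 ^+ 3 = n ^+ 2 * (W1 * (W1 / n) ^+ 2) by field; rewrite lt0r_neq0.
by rewrite ler_pM2l // exprn_gt0.
Qed.

(** * The energy inequality *)

Section EnergyInequality.
Variables (R : realType) (A : {fset R}).

Let D : {fset R} := [fset a - b | a in A, b in A].
Let r : R -> R := rep A A.
Let n : R := #|` A|%:R.

Definition moment (k : nat) : R := \sum_(c <- D) r c ^+ k.

Let r0 c : 0 <= r c. Proof. exact: rep_ge0. Qed.

Let memD x y : x \in A -> y \in A -> x - y \in D.
Proof. by move=> xA yA; apply/imfset2P; exists x => //; exists y. Qed.

Lemma moment_ge0 k : 0 <= moment k.
Proof. by apply: sumr_ge0 => c _; rewrite exprn_ge0. Qed.

(** The quadratic form of the Gram matrix [r (a - b)], written as a sum of squares. *)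
Lemma sum_sqr_rep (S Z : {fset R}) (h : R -> R) :
  {in A & S, forall x a, x - a \in Z} ->
  \sum_(z <- Z) (\sum_(a <- S) h a * (z + a \in A)%:R) ^+ 2
    = \sum_(a <- S) \sum_(b <- S) h a * h b * r (a - b).
Proof.
move=> AZ.
transitivity (\sum_(z <- Z) \sum_(a <- S) \sum_(b <- S)
    h a * h b * ((z + a \in A)%:R * (z + b \in A)%:R)).
  apply: eq_bigr => z _; rewrite expr2 mulr_suml; apply: eq_bigr => a _.
  by rewrite mulr_sumr; apply: eq_bigr => b _; ring.
rewrite exchange_big /=; apply: eq_bigr => a _.
rewrite exchange_big /= big_seq [RHS]big_seq; apply: eq_bigr => b bS.
by rewrite -mulr_sumr -rep_sub // => x xA; exact: AZ.
Qed.

Lemma sum_differences (g : R -> R) :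
  \sum_(x <- A) \sum_(y <- A) g (x - y) = \sum_(c <- D) r c * g c.
Proof.
rewrite exchange_big /=.
transitivity (\sum_(y <- A) \sum_(c <- D) (c + y \in A)%:R * g c).
  rewrite big_seq [RHS]big_seq; apply: eq_bigr => y yA.
  rewrite (@sum_shift _ A D y) => [|x xA]; last exact: memD.
  by apply: eq_bigr => c _; rewrite addrK.
by rewrite exchange_big /=; apply: eq_bigr => c _; rewrite -mulr_suml.
Qed.

(** Counts the translates of the triple 0, [a], [b] inside [A]. *)
Definition common (a b : R) : R := \sum_(y <- A) (a + y \in A)%:R * (b + y \in A)%:R.

(** Squaring brings in two points [y], [z]. For fixed [y], [z] the sums over [a] and [b] separate,
    each being [r (y - z)]. *)
Lemma sum_sqr_common : \sum_(a <- D) \sum_(b <- D) common a b ^+ 2 = moment 3.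
Proof.
transitivity (\sum_(y <- A) \sum_(z <- A) r (y - z) ^+ 2).
  transitivity (\sum_(a <- D) \sum_(b <- D) \sum_(y <- A) \sum_(z <- A)
    ((a + y \in A)%:R * (a + z \in A)%:R) * ((b + y \in A)%:R * (b + z \in A)%:R) : R).
    apply: eq_bigr => a _; apply: eq_bigr => b _; rewrite expr2 mulr_suml.
    apply: eq_bigr => y _; rewrite mulr_sumr; apply: eq_bigr => z _; ring.
  under eq_bigr do rewrite exchange_big /=.
  rewrite exchange_big /= big_seq [RHS]big_seq; apply: eq_bigr => y yA.
  under eq_bigr do rewrite exchange_big /=.
  rewrite exchange_big /= big_seq [RHS]big_seq; apply: eq_bigr => z zA.
  rewrite /r (@rep_sub _ A D) => [|x xA]; last exact: memD.
  by rewrite expr2 mulr_suml; apply: eq_bigr => a _; rewrite mulr_sumr.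
rewrite (sum_differences (fun c => r c ^+ 2)).
by apply: eq_bigr => c _; rewrite -exprS.
Qed.

(** * Truncated representation function and triangles *)

Section Truncation.
Variable Delta : R.
Hypothesis Delta0 : 0 < Delta.

Let m (c : R) : R := if r c <= Delta then r c else 0.

Let m0 c : 0 <= m c. Proof. by rewrite /m; case: ifP. Qed.
Let m_le c : m c <= r c. Proof. by rewrite /m; case: ifP. Qed.
Let mN c : m (- c) = m c. Proof. by rewrite /m /r rep_opp. Qed.
Let m_sqr c : m c ^+ 2 <= Delta * r c.
Proof.
rewrite /m; case: ifP => h; first by rewrite expr2 ler_wpM2r.
by rewrite expr0n /= mulr_ge0 // ltW.
Qed.

Definition triangles : R :=
  \sum_(x <- A) \sum_(y <- A) \sum_(u <- A) m (x - y) * m (x - u) * r (y - u).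

(** Where [r c > Delta], the lost [r c ^+ 2] is at most [r c ^+ 3 / Delta]. *)
Lemma sum_truncated_ge :
  moment 2 - moment 3 / Delta <= \sum_(x <- A) \sum_(y <- A) m (x - y).
Proof.
rewrite sum_differences lerBlDr /moment mulr_suml -big_split /=.
apply: ler_sum => c _; rewrite /m; case: (leP (r c) Delta) => h.
  by rewrite -expr2 lerDl divr_ge0 ?exprn_ge0 // ltW.
by rewrite mulr0 add0r ler_pdivlMr // [r c ^+ 3]exprSr ler_wpM2l ?sqr_ge0 // ltW.
Qed.

(* The middle edge of a walk of length 3 is relaxed from [m] to [r], whose matrix
   [r (y - u)] is a Gram matrix, so that Cauchy-Schwarz closes the walk up. *)
Lemma triangles_ge :
  (\sum_(x <- A) \sum_(y <- A) m (x - y)) ^+ 3 <= n ^+ 3 * triangles.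
Proof.
apply: le_trans (@walks3_ge R R A (fun x y => m (x - y)) _ _) _ => //.
  by move=> x y; rewrite -mN opprB.
rewrite [n ^+ 3]exprSr -[leRHS]mulrA; apply: ler_wpM2l; first exact: sqr_ge0.
pose d y := \sum_(x <- A) m (x - y).
have d0 y : 0 <= d y by apply: sumr_ge0.
apply: (@le_trans _ _ (\sum_(y <- A) \sum_(u <- A) d y * d u * r (y - u))).
  apply: ler_sum => y _; apply: ler_sum => u _.
  by apply: ler_wpM2l; [exact: mulr_ge0 (d0 y) (d0 u) | exact: m_le].
rewrite -(@sum_sqr_rep A D); last by move=> x a; exact: memD.
(* For fixed [z], opening the degrees gives a sum over [x] in [A]; Cauchy-Schwarz over [x] costs [n]
   and leaves two edges from the same [x]. *)
apply: (@le_trans _ _ (\sum_(z <- D) n * \sum_(x <- A)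
    (\sum_(y <- A) m (x - y) * (z + y \in A)%:R) ^+ 2)).
  apply: ler_sum => z _.
  rewrite (_ : \sum_(a <- A) d a * _ = \sum_(x <- A) \sum_(y <- A) m (x - y) * (z + y \in A)%:R).
    exact: sqr_sum_le.
  by rewrite exchange_big /=; apply: eq_bigr => y _; rewrite mulr_suml.
rewrite -mulr_sumr ler_wpM2l ?ler0n // exchange_big /=.
rewrite le_eqVlt; apply/orP; left; apply/eqP; apply: eq_bigr => x _.
by rewrite sum_sqr_rep // => ? ?; exact: memD.
Qed.

(** Substitute [x = a + y] and [u = b + y]; the weights no longer involve [y], whose sum is
    [common a b]. *)
Lemma trianglesE : triangles =
  \sum_(a <- D) \sum_(b <- D) m a * r b * m (a - b) * common a b.
Proof.
rewrite /triangles exchange_big /=.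
transitivity (\sum_(y <- A) \sum_(a <- D) \sum_(b <- D)
   m a * r b * m (a - b) * ((a + y \in A)%:R * (b + y \in A)%:R)).
  rewrite big_seq [RHS]big_seq; apply: eq_bigr => y yA.
  rewrite (@sum_shift _ A D y) => [|x xA]; last exact: memD.
  apply: eq_bigr => a _; rewrite (@sum_shift _ A D y) => [|x xA]; last exact: memD.
  rewrite mulr_sumr; apply: eq_bigr => b _.
  have -> : a + y - y = a by ring.
  have -> : a + y - (b + y) = a - b by ring.
  have -> : y - (b + y) = - b by ring.
  by rewrite /r rep_opp; ring.
rewrite exchange_big /=; apply: eq_bigr => a _.
by rewrite exchange_big /=; apply: eq_bigr => b _; rewrite -mulr_sumr.
Qed.

(** Cauchy-Schwarz splits off [common]. In the other factor [m a] is relaxed to [r a], while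
    [m (a - b) ^+ 2 <= Delta * r (a - b)] uses the truncation. *)
Lemma triangles_sqr_le : triangles ^+ 2 <= moment 3 *
  (Delta * \sum_(a <- D) \sum_(b <- D) r a ^+ 2 * r b ^+ 2 * r (a - b)).
Proof.
rewrite trianglesE; apply: le_trans (sum2_cauchy_schwarz _ _ _ _) _.
rewrite sum_sqr_common mulrC ler_wpM2l ?moment_ge0 //.
rewrite mulr_sumr; apply: ler_sum => a _; rewrite mulr_sumr; apply: ler_sum => b _.
have -> : (m a * r b * m (a - b)) ^+ 2 = m a ^+ 2 * r b ^+ 2 * m (a - b) ^+ 2 by ring.
have -> : Delta * (r a ^+ 2 * r b ^+ 2 * r (a - b)) = r a ^+ 2 * r b ^+ 2 * (Delta * r (a - b)).
  by ring.
apply: ler_pM => //; rewrite ?mulr_ge0 ?sqr_ge0 //.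
by rewrite ler_wpM2r ?sqr_ge0 // lerXn2r ?nnegrE.
Qed.

End Truncation.

(** * Dyadic level sets of the representation function *)

Section DyadicLevels.
Variables (K : R) (J : nat).
Hypothesis K0 : 0 <= K.
Hypothesis AJ : (#|` A| < 2 ^ J)%N.
Hypothesis third_moment : forall P X : {fset R},
  \sum_(w <- X) rep A P w ^+ 3 <= K * n * #|` P|%:R ^+ 2.

Let P (j : nat) : {fset R} := [fset c in D | 2 ^+ j <= r c].

Lemma card_level_le j k : (2 ^+ j) ^+ k * #|` P j|%:R <= moment k.
Proof.
rewrite /P -(sum_indicator_card R D (fun c => 2 ^+ j <= r c)) mulr_sumr.
apply: ler_sum => c _; case: (leP (2 ^+ j) (r c)) => h; rewrite ?mulr1 ?mulr0 ?exprn_ge0 //.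
by rewrite lerXn2r ?nnegrE // exprn_ge0.
Qed.

(** With [p] the size of [P j], the first and third moments of [rep A (P j)] bound the square of the
    second by [K * n ^+ 2 * p ^+ 3]. One factor [p] is paid for by [moment 2] and two by [moment 3],
    which uses up exactly the weight [(16 ^+ j) ^+ 2]. *)
Lemma level_energy_le j (X : {fset R}) :
  16 ^+ j * \sum_(w <- X) rep A (P j) w ^+ 2
    <= Num.sqrt (K * n ^+ 2 * moment 2 * moment 3 ^+ 2).
Proof.
have s0 : 0 <= 16 ^+ j * \sum_(w <- X) rep A (P j) w ^+ 2.
  by rewrite mulr_ge0 ?exprn_ge0 // sumr_ge0 // => w _; rewrite sqr_ge0.
rewrite -(ger0_norm s0) -sqrtr_sqr ler_sqrt; last first.
  by rewrite !mulr_ge0 ?sqr_ge0 ?moment_ge0.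
rewrite exprMn; set S := \sum_(w <- X) _.
pose p : R := #|` P j|%:R; have p0 : 0 <= p by exact: ler0n.
have n0 : 0 <= n by exact: ler0n.
have hS : S ^+ 2 <= n * p * (K * n * p ^+ 2).
  apply: le_trans (sum_sqr_logconvex _ _) _ => [w|]; first exact: rep_ge0.
  by apply: ler_pM; rewrite ?sumr_ge0 ?sum_rep_le ?third_moment // => w _;
     rewrite ?exprn_ge0 ?rep_ge0.
apply: (@le_trans _ _ ((16 ^+ j) ^+ 2 * (n * p * (K * n * p ^+ 2)))).
  by rewrite ler_wpM2l // sqr_ge0.
have q0 : 0 <= 2 ^+ j :> R by rewrite exprn_ge0.
have -> : 16 ^+ j = (2 ^+ j) ^+ 4 :> R.
  by rewrite -exprM mulnC exprM; congr (_ ^+ _); ring.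
have -> : ((2 ^+ j) ^+ 4) ^+ 2 * (n * p * (K * n * p ^+ 2)) =
  K * n ^+ 2 * ((2 ^+ j) ^+ 2 * p) * ((2 ^+ j) ^+ 3 * p) ^+ 2 by ring.
have l2 := card_level_le j 2; have l3 := card_level_le j 3.
have kn : 0 <= K * n ^+ 2 by rewrite mulr_ge0 ?sqr_ge0.
apply: ler_pM; rewrite ?sqr_ge0 //.
- by rewrite mulr_ge0 // mulr_ge0 ?exprn_ge0.
- by rewrite ler_wpM2l.
- by rewrite lerXn2r ?nnegrE ?moment_ge0 // mulr_ge0 ?exprn_ge0.
Qed.

(** The left side is a sum over [w] of squares. Bounding [r a ^+ 2] dyadically turns each into a
    combination of [rep A (P j) w]; Cauchy-Schwarz over the levels costs one [J], the final sum over
    them another. *)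
Lemma weighted_energy_le :
  \sum_(a <- D) \sum_(b <- D) r a ^+ 2 * r b ^+ 2 * r (a - b)
    <= 16 * J%:R ^+ 2 * Num.sqrt (K * n ^+ 2 * moment 2 * moment 3 ^+ 2).
Proof.
pose W : {fset R} := [fset x - a | x in A, a in D].
rewrite -(@sum_sqr_rep D W (fun a => r a ^+ 2)); last first.
  by move=> x a xA aD; apply/imfset2P; exists x => //; exists a.
set Q := Num.sqrt _.
apply: (@le_trans _ _ (\sum_(w <- W)
    J%:R * \sum_(j < J) 16 * (16 ^+ j * rep A (P j) w ^+ 2))).
  apply: ler_sum => w _.
  apply: (@le_trans _ _ ((\sum_(j < J) (2 ^+ j.+1) ^+ 2 * rep A (P j) w) ^+ 2)).
    rewrite lerXn2r ?nnegrE ?sumr_ge0 // => [a _|j _|].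
    - by rewrite mulr_ge0 ?sqr_ge0 ?natb_ge0.
    - by rewrite mulr_ge0 ?sqr_ge0 ?rep_ge0.
    have -> : \sum_(j < J) (2 ^+ j.+1) ^+ 2 * rep A (P j) w =
       \sum_(a <- D) (\sum_(j < J) (2 ^+ j.+1) ^+ 2 * (2 ^+ j <= r a)%R%:R) * (w + a \in A)%:R.
      under [RHS]eq_bigr do rewrite mulr_suml.
      rewrite exchange_big /=; apply: eq_bigr => j _.
      rewrite /rep /P (sum_fset_filter D (fun c => 2 ^+ j <= r c)) mulr_sumr.
      by apply: eq_bigr => a _; rewrite mulrA.
    apply: ler_sum => a _; apply: ler_wpM2r => //.
    apply: dyadic_expr_le => //; first exact: rep_eq0_or_ge1.
    by apply: le_lt_trans (rep_le_cardl _ _ _) _; rewrite -natrX ltr_nat.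
  apply: le_trans (sqr_sum_le _ _) _.
  rewrite -sum_one sumr_const card_ord.
  rewrite ler_wpM2l // le_eqVlt; apply/orP; left; apply/eqP; apply: eq_bigr => j _.
  have -> : 16 ^+ j = (2 ^+ j) ^+ 4 :> R.
    by rewrite -exprM mulnC exprM; congr (_ ^+ _); ring.
  by rewrite (exprS 2 j); ring.
rewrite -mulr_sumr exchange_big /= expr2 mulrA -!mulrA [16 * _]mulrC -!mulrA ler_wpM2l //.
have -> : J%:R * (Q * 16) = \sum_(j < J) 16 * Q.
  by rewrite sumr_const card_ord -mulr_natl; ring.
apply: ler_sum => j _; rewrite -!mulr_sumr ler_wpM2l //.
exact: level_energy_le.
Qed.

Lemma energy_expr13_le :
  moment 2 ^+ 13 <= 2 ^+ 22 * J%:R ^+ 4 * K * n ^+ 14 * moment 3 ^+ 6.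
Proof.
have e20 := moment_ge0 2; have e30 := moment_ge0 3.
have n0 : 0 <= n by exact: ler0n.
set E := moment 2 in e20 *; set E3 := moment 3 in e30 *.
have rhs0 : 0 <= 2 ^+ 22 * J%:R ^+ 4 * K * n ^+ 14 * E3 ^+ 6.
  by rewrite mulr_ge0 ?mulr_ge0 ?exprn_ge0.
have [E0|En0] := eqVneq E 0; first by rewrite E0 expr0n.
have E0 : 0 < E by rewrite lt_neqAle eq_sym En0.
have E30 : 0 < E3.
  rewrite lt_neqAle e30 andbT eq_sym; apply: contraNneq En0 => h.
  have := @sum_sqr_logconvex R _ D r r0; rewrite -/(moment 3) -/E3 h mulr0.
  rewrite -/(moment 2) -/E => h2; apply/eqP.
  by have := le_anti (introT andP (conj h2 (sqr_ge0 E))) => /eqP; rewrite expf_eq0 /= => /eqP.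
(* The differences with [r c > Delta] carry at most half of the energy. *)
pose Delta := 2 * E3 / E; have Delta0 : 0 < Delta by rewrite divr_gt0 // mulr_gt0.
have := sum_truncated_ge Delta0; have := triangles_ge Delta.
have := triangles_sqr_le Delta0; rewrite -/E -/E3.
set T := triangles Delta; set W1 := \sum_(x <- A) _; set F2 := \sum_(a <- D) _.
move=> hT hW hE.
have F2Q : F2 <= _ := weighted_energy_le.
have F20 : 0 <= F2.
  apply: sumr_ge0 => a _; apply: sumr_ge0 => b _.
  by rewrite mulr_ge0 // mulr_ge0 ?sqr_ge0.
have EW : E / 2 <= W1.
  by have -> : E / 2 = E - E3 / Delta by rewrite /Delta; field; rewrite !lt0r_neq0.
have h1 : (E / 2) ^+ 3 <= n ^+ 3 * T.
  by apply: le_trans hW; rewrite lerXn2r ?nnegrE ?(le_trans _ EW) // divr_ge0.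
have h2 : (E / 2) ^+ 6 <= n ^+ 6 * T ^+ 2.
  have -> : (E / 2) ^+ 6 = ((E / 2) ^+ 3) ^+ 2 by ring.
  have -> : n ^+ 6 * T ^+ 2 = (n ^+ 3 * T) ^+ 2 by ring.
  by rewrite lerXn2r ?nnegrE ?(le_trans _ h1) // exprn_ge0 // divr_ge0.
have h3 : (E / 2) ^+ 6 <= n ^+ 6 * (E3 * (Delta * F2)).
  by apply: le_trans h2 _; rewrite ler_wpM2l // exprn_ge0.
have h4 : F2 ^+ 2 <= 256 * J%:R ^+ 4 * (K * n ^+ 2 * E * E3 ^+ 2).
  apply: (@le_trans _ _ ((16 * J%:R ^+ 2 * Num.sqrt (K * n ^+ 2 * E * E3 ^+ 2)) ^+ 2)).
    by rewrite lerXn2r ?nnegrE ?(le_trans F20).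
  by rewrite exprMn sqr_sqrtr ?mulr_ge0 ?sqr_ge0 // le_eqVlt; apply/orP; left; apply/eqP; ring.
(* One more squaring removes the square root in the bound for [F2]; substituting [Delta] then leaves
   [E ^+ 13] on the left. *)
have h5 : ((E / 2) ^+ 6) ^+ 2 <= n ^+ 12 * E3 ^+ 2 * Delta ^+ 2 *
    (256 * J%:R ^+ 4 * (K * n ^+ 2 * E * E3 ^+ 2)).
  apply: (@le_trans _ _ ((n ^+ 6 * (E3 * (Delta * F2))) ^+ 2)).
    rewrite lerXn2r ?nnegrE ?exprn_ge0 ?divr_ge0 //.
    apply: mulr_ge0; first exact: exprn_ge0.
    by apply: mulr_ge0 => //; apply: mulr_ge0 => //; exact: ltW.
  have -> : (n ^+ 6 * (E3 * (Delta * F2))) ^+ 2 = n ^+ 12 * E3 ^+ 2 * Delta ^+ 2 * F2 ^+ 2 by ring.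
  apply: ler_wpM2l => //; apply: mulr_ge0; last exact: sqr_ge0.
  by apply: mulr_ge0; [exact: exprn_ge0 | exact: sqr_ge0].
have -> : E ^+ 13 = 2 ^+ 12 * E * ((E / 2) ^+ 6) ^+ 2 by field.
apply: (@le_trans _ _ (2 ^+ 12 * E * (n ^+ 12 * E3 ^+ 2 * Delta ^+ 2 *
    (256 * J%:R ^+ 4 * (K * n ^+ 2 * E * E3 ^+ 2))))).
  by rewrite ler_wpM2l // mulr_ge0 // exprn_ge0.
by rewrite le_eqVlt; apply/orP; left; apply/eqP; rewrite /Delta; field.
Qed.

End DyadicLevels.

End EnergyInequality.

(** * The bound on the energy *)

(** Quadruples are grouped by the common difference [c]. *)
Lemma additive_energyE (R : realType) (A : {fset R}) :
  (additive_energy A)%:R = moment A 2.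
Proof.
rewrite /additive_energy -(sum_indicator_card R _
  (fun q : (R * R) * (R * R) => q.1.1 - q.1.2 == q.2.1 - q.2.2)).
rewrite !big_imfset2 /=; try by move=> [? ?] [? ?] _ _ /= [-> ->].
transitivity (\sum_(x <- A) \sum_(y <- A) \sum_(z <- A) \sum_(w <- A)
    (x - y == z - w)%:R : R).
  apply: eq_bigr => x _; apply: eq_bigr => y _.
  by rewrite big_imfset2 // => [[? ?] [? ?] _ _ /= [-> ->]].
rewrite (@sum_differences _ A (fun c => \sum_(z <- A) \sum_(w <- A) (c == z - w)%:R)).
apply: eq_bigr => c _; rewrite expr2; congr (_ * _).
rewrite exchange_big /=; apply: eq_bigr => w _.
by rewrite -sum_pred1; apply: eq_bigr => z _; rewrite eq_sym subr_eq.
Qed.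

(* The products with elements of least and of greatest modulus overlap in at
   most the two values of modulus equal to the product of these moduli. *)
Lemma product_set_card_ge (R : realType) (A : {fset R}) :
  (2 * #|` A| <= #|` product_set A| + 4)%N.
Proof.
pose B := A `\ 0%R.
have AB : (#|` A| <= #|` B|.+1)%N.
  by rewrite (cardfsD1 0%R A) -/B; case: (_ \in _); rewrite ?add1n ?add0n.
have [B0|/fset0Pn[b0 b0B]] := eqVneq B fset0.
  move: AB; rewrite B0 cardfs0 => A1.
  by rewrite (leq_trans (leq_mul (leqnn 2) A1)) // muln1 (leq_trans _ (leq_addl _ 4)).
have [/= u _ umin] := @arg_minP _ _ _ [` b0B] xpredT (fun x : B => `|val x|) isT.
have [/= v _ vmax] := @arg_maxP _ _ _ [` b0B] xpredT (fun x : B => `|val x|) isT.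
have Bnz (x : B) : val x != 0 by have := valP x; rewrite !inE => /andP[].
have BA x : x \in B -> x \in A by rewrite !inE => /andP[].
pose S (t : R) := [fset t * a | a in B].
have cS (x : B) : #|` S (val x)| = #|` B|.
  by rewrite card_imfset //= => a b /(mulfI (Bnz x)).
have SA (x : B) : S (val x) `<=` product_set A.
  apply/fsubsetP => y /imfsetP[a /= aB ->].
  by apply/imfset2P; exists (val x); [exact: BA (valP x)|exists a => //; exact: BA].
(* A common value is [u * a = v * b]; its modulus is at most that of [u * v] by maximality of [v],
   and at least that by minimality of [u]. *)
have SI : S (val u) `&` S (val v) `<=` [fset `|val u * val v|; - `|val u * val v|].
  apply/fsubsetP => y; rewrite !inE => /andP[/imfsetP[a /= aB yu] /imfsetP[b /= bB yv]].
  rewrite -[_ || _]andbT -(normr_ge0 (val u * val v)) -eqr_norml eq_le.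
  apply/andP; split.
    rewrite yu !normrM ler_wpM2l ?normr_ge0 //; exact: vmax [` aB] isT.
  rewrite yv !normrM mulrC ler_wpM2l ?normr_ge0 //; exact: umin [` bB] isT.
have SU : S (val u) `|` S (val v) `<=` product_set A by rewrite fsubUset !SA.
have := cardfsUI (S (val u)) (S (val v)); rewrite !cS addnn -mul2n => hc.
have h1 := fsubset_leq_card SU; have := fsubset_leq_card SI; rewrite cardfs2 => h2.
apply: (@leq_trans (2 * #|` B|.+1)); first by rewrite leq_mul2l.
rewrite mulnS -hc addnC -[4%N]/(2 + 2)%N addnA leq_add2r leq_add //.
by apply: leq_trans h2 _; case: (_ != _).
Qed.

(** For [n <= 8] integrality gives [M >= 1 + 1 / n]; for larger [n], [product_set_card_ge] gives
    [M >= 2 - 4 / n]. *)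
Lemma multiplicative_doubling_ge (R : realType) (A : {fset R}) (M : R) :
  1 < M -> #|` product_set A|%:R = M * #|` A|%:R -> (0 < #|` A|)%N -> 9 / 8 <= M.
Proof.
move=> M1 AM A0.
have n0 : 0 < #|` A|%:R :> R by rewrite ltr0n.
have h1 : #|` A|%:R + 1 <= M * #|` A|%:R.
  by rewrite -AM natr1 ler_nat -(ltr_nat R) AM ltr_pMl.
have h2 : 2 * #|` A|%:R <= M * #|` A|%:R + 4.
  by rewrite -AM -natrM -natrD ler_nat product_set_card_ge.
rewrite -(ler_pM2r n0).
move: h1 h2; set n := #|` A|%:R => h1 h2.
by case: (leP n 8) => hn; lra.
Qed.

Theorem theorem30 (R : realType) :
  exists C : R, 0 < C /\
    forall (A : {fset R}) (M : R),
      (2 <= #|` A|)%N ->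
      1 < M ->
      #|` product_set A|%:R = M * #|` A|%:R ->
      (additive_energy A)%:R <=
        C * (M * log2 M) `^ (14 / 13)
          * #|` A|%:R `^ (32 / 13)
          * (log2 #|` A|%:R) `^ (71 / 65).
Proof.
have ln2 : 0 < ln 2 :> R by rewrite ln_gt0 // ltr1n.
pose kappa : R := log2 (9 / 8).
have kappa0 : 0 < kappa by rewrite divr_gt0 // ln_gt0; lra.
(* The power of 2 collects [2 ^+ 22] from [energy_expr13_le], [2048 ^+ 7] from seven factors [K] and
   [2 ^+ 11] from [J <= 2 * L]; [kappa ^+ 14] comes from [M <= G / kappa]. *)
pose c : R := 2 ^+ 110 / kappa ^+ 14.
have c0 : 0 < c by rewrite divr_gt0 // exprn_gt0.
exists (c `^ 13^-1); split; first exact: powR_gt0.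
move=> A M A2 M1 AM; set n : R := #|` A|%:R.
have n2 : 2 <= n by rewrite ler_nat.
have n0 : 0 < n by lra.
have A0 : (0 < #|` A|)%N by apply: leq_trans A2.
have M98 := multiplicative_doubling_ge M1 AM A0.
have L1 : 1 <= log2 n by rewrite ler_pdivlMr // mul1r ler_ln ?posrE.
have kM : kappa <= log2 M by rewrite ler_pM2r ?invr_gt0 // ler_ln ?posrE //; lra.
set L := log2 n in L1 *; set G := M * log2 M.
have MG : M <= G / kappa by rewrite ler_pdivlMr // ler_pM2l // (lt_trans ltr01 M1).
have G0 : 0 < G by rewrite mulr_gt0 ?(lt_le_trans kappa0 kM) //; lra.
pose J := (trunc_log 2 #|` A|).+1.
have /andP[tJ AJ] := trunc_log_bounds (isT : (1 < 2)%N) A0.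
rewrite -/J in AJ.
have J2L : J%:R <= 2 * L.
  suff : (trunc_log 2 #|` A|)%:R <= L by rewrite /J -natr1; lra.
  rewrite ler_pdivlMr // mulr_natl -lnXn // ler_ln ?posrE ?exprn_gt0 //.
  by rewrite -natrX ler_nat.
pose K : R := 2048 * J%:R * M ^+ 2.
have K0 : 0 <= K by rewrite mulr_ge0 ?sqr_ge0 ?mulr_ge0.
have third (P X : {fset R}) : \sum_(w <- X) rep A P w ^+ 3 <= K * n * #|` P|%:R ^+ 2.
  rewrite -(ler_pM2l n0); apply: le_trans (@third_moment_le R A P X J A2 AJ) _.
  by rewrite AM -/n le_eqVlt; apply/orP; left; apply/eqP; rewrite /K; ring.
have E3 : moment A 3 <= K * n ^+ 3.
  by apply: le_trans (third A _) _; rewrite -/n -mulrA -exprS.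
rewrite additive_energyE; set E := moment A 2.
have E0 : 0 <= E := moment_ge0 A 2.
have main : E ^+ 13 <= c * G ^+ 14 * n ^+ 32 * L ^+ 11.
  apply: le_trans (energy_expr13_le K0 AJ third) _; rewrite -/n.
  apply: (@le_trans _ _ (2 ^+ 22 * J%:R ^+ 4 * K * n ^+ 14 * (K * n ^+ 3) ^+ 6)).
    apply: ler_wpM2l; last by rewrite lerXn2r ?nnegrE ?moment_ge0 // mulr_ge0 ?exprn_ge0 // ltW.
    apply: mulr_ge0; last exact: exprn_ge0 (ltW n0).
    by apply: mulr_ge0 => //; apply: mulr_ge0; exact: exprn_ge0.
  have -> : 2 ^+ 22 * J%:R ^+ 4 * K * n ^+ 14 * (K * n ^+ 3) ^+ 6
      = 2 ^+ 99 * (J%:R ^+ 11 * M ^+ 14 * n ^+ 32).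
    by rewrite /K; ring.
  have -> : c * G ^+ 14 * n ^+ 32 * L ^+ 11
      = 2 ^+ 99 * ((2 * L) ^+ 11 * (G / kappa) ^+ 14 * n ^+ 32).
    by rewrite /c; field; rewrite lt0r_neq0.
  rewrite ler_pM2l ?exprn_gt0 // ler_pM2r ?exprn_gt0 //.
  apply: ler_pM; rewrite ?exprn_ge0 //; try lra.
    by rewrite lerXn2r ?nnegrE ?ler0n //; lra.
  by rewrite lerXn2r ?nnegrE ?(le_trans _ MG) //; lra.
(* Keeps unification from unfolding the large numeral in [c]. *)
clearbody c L G E.
have root k (x : R) : 0 <= x -> (x ^+ k) `^ 13^-1 = x `^ (k%:R / 13).
  by move=> x0; rewrite -powR_mulrn // -powRrM.
have -> : E = (E ^+ 13) `^ 13^-1 by rewrite root // divff ?pnatr_eq0 // powRr1.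
apply: (@le_trans _ _ ((c * G ^+ 14 * n ^+ 32 * L ^+ 11) `^ 13^-1)).
  have h := le_trans (exprn_ge0 13 E0) main.
  by apply: ge0_ler_powR; rewrite ?nnegrE ?invr_ge0 ?exprn_ge0.
have L0 : 0 <= L by lra.
have gG : 0 <= G ^+ 14 := exprn_ge0 14 (ltW G0).
have gn : 0 <= n ^+ 32 := exprn_ge0 32 (ltW n0).
have gL : 0 <= L ^+ 11 := exprn_ge0 11 L0.
have gcG := mulr_ge0 (ltW c0) gG; have gcGn := mulr_ge0 gcG gn.
rewrite (powRM _ gcGn gL) (powRM _ gcG gn) (powRM _ (ltW c0) gG).
rewrite (root 14 _ (ltW G0)) (root 32 _ (ltW n0)) (root 11 _ L0).
apply: ler_wpM2l; first by rewrite !mulr_ge0 ?powR_ge0.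
(* As [L >= 1], the exponent 11/13 may be raised to 71/65. *)
by apply: ler_powR => //; lra.
Qed.
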